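(* The second-order RMSAV-BDF2 scheme (defined in the context) is unconditionally energy stable. That is, for every time step $\delta t>0$, every $\eta\in[0,1]$ and every choice of $\xi_0\in\mathcal V$ at each step, for $n\ge1$ its solutions satisfy $$\mathcal E_h^{n+1}-\mathcal E_h^{n}\le-\delta t\,(1-\eta)\,(\mathcal G\mu^{n+1},\mu^{n+1})\le 0,$$ where $$\mathcal E_h^{n}=\frac14\Big[\big(\phi^{n},(\mathcal L+\textstyle\sum_{i=1}^k\gamma_i I)\phi^{n}\big)+\big(2\phi^{n}-\phi^{n-1},(\mathcal L+\textstyle\sum_{i=1}^k\gamma_i I)(2\phi^{n}-\phi^{n-1})\big)\Big]+\sum_{i=1}^k\Big[(q_i^{n})^2+(2q_i^{n}-q_i^{n-1})^2\Big].$$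
   Context: Setting. $\Omega$ is the spatial domain, with periodic boundary conditions; $(f,g)=\int_\Omega fg\,d\mathbf x$, and $I$ is the identity operator. The free energy is $\mathcal E(\phi)=\int_\Omega\big(\frac12\phi\mathcal L\phi+\sum_{i=1}^kF_i(\phi)\big)d\mathbf x$, where $\mathcal L$ is a linear operator and $F_1,\dots,F_k$ are the bulk potentials, with derivatives $F_i'$. The mobility $\mathcal G$ is a semi-positive definite operator (dissipative systems), or a skew-symmetric operator (reversible systems). The gradient flow being approximated is $\partial_t\phi=-\mathcal G\big(\mathcal L\phi+\sum_{i=1}^kF_i'(\phi)\big)$. For $i=1,\dots,k$ put $$Q_i(\phi)=\sqrt{\int_\Omega\big(F_i(\phi)-\tfrac12\gamma_i\phi^2\big)d\mathbf x+C_i},\qquad V_i(\phi)=F_i'(\phi)-\gamma_i\phi,$$ where the $\gamma_i$ are regularization constants and the $C_i$ are positive constants making the square roots well defined (with positive radicands). The time interval $[0,T]$ is divided by $t_m=m\,\delta t$, $\delta t=T/N$, and a superscript $n$ denotes the numerical approximation at $t_n$. RMSAV-BDF2 scheme. Given $\phi^{n-1},\phi^n$ (functions) and $q_i^{n-1},q_i^n$ (real numbers, $i=1,\dots,k$), let $\overline\phi^{\,n+1}=\frac32\phi^n-\frac12\phi^{n-1}$. Step 1: compute $\phi^{n+1}$ and $\tilde q_1^{\,n+1},\dots,\tilde q_k^{\,n+1}$, together with $\mu^{n+1}$, from $$\frac{3\phi^{n+1}-4\phi^n+\phi^{n-1}}{2\delta t}=-\mathcal G\mu^{n+1},$$ $$\mu^{n+1}=\mathcal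 L\phi^{n+1}+\sum_{i=1}^k\gamma_i\phi^{n+1}+\sum_{i=1}^k\frac{\tilde q_i^{\,n+1}}{Q_i(\overline\phi^{\,n+1})}V_i(\overline\phi^{\,n+1}),$$ $$\frac{3\tilde q_j^{\,n+1}-4q_j^n+q_j^{n-1}}{2\delta t}=\int_\Omega\frac{V_j(\overline\phi^{\,n+1})}{2Q_j(\overline\phi^{\,n+1})}\,\frac{3\phi^{n+1}-4\phi^n+\phi^{n-1}}{2\delta t}\,d\mathbf x,\quad j=1,\dots,k.$$ Step 2 (relaxation): set $q_i^{n+1}=\xi_0\tilde q_i^{\,n+1}+(1-\xi_0)Q_i(\phi^{n+1})$, $i=1,\dots,k$, with some $\xi_0\in\mathcal V$ (the same for all $i$), where $\mathcal V$ is the set of all $\xi\in[0,1]$ such that, with $r_i=\xi\tilde q_i^{\,n+1}+(1-\xi)Q_i(\phi^{n+1})$, $$\sum_{i=1}^k\Big[r_i^2+(2r_i-q_i^n)^2-\big((\tilde q_i^{\,n+1})^2+(2\tilde q_i^{\,n+1}-q_i^n)^2\big)\Big]\le\delta t\,\eta\,(\mathcal G\mu^{n+1},\mu^{n+1}),$$ and $\eta\in[0,1]$ is a parameter.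
   Formalization: The sum over the q_i in the discrete energy carries weight 1/2 instead of 1, and L is assumed symmetric with L + sum of gamma_i I semi-positive definite on its domain; the claim fails without these changes. *)

(* Defs.v *)
From HB Require Import structures.
From mathcomp Require Import all_boot all_order all_algebra.
From mathcomp Require Import all_classical all_reals all_analysis.

Set Implicit Arguments.
Unset Strict Implicit.
Unset Printing Implicit Defensive.
Import Order.TTheory GRing.Theory Num.Theory.
Import numFieldNormedType.Exports.

Local Open Scope classical_set_scope.
Local Open Scope ring_scope.

(* The library has no Lebesgue measure on n.-tuple R: it is built here as the
   image of lebesgue_measure \x (measure in dimension n) under (x, t) |-> x :: t,
   starting from the Dirac mass at the empty tuple. *)
Section lebesgue_tuple.
Variable R : realType.

Definition tcons n (p : measurableTypeR R * n.-tuple (measurableTypeR R)) :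
    n.+1.-tuple (measurableTypeR R) :=
  [the n.+1.-tuple (measurableTypeR R) of p.1 :: p.2].

Definition tuncons n (t : n.+1.-tuple (measurableTypeR R)) :
    measurableTypeR R * n.-tuple (measurableTypeR R) :=
  (thead t, [tuple of behead t]).

Lemma measurable_tcons n : measurable_fun [set: _] (@tcons n).
Proof. exact: measurable_cons. Qed.

Lemma measurable_tuncons n : measurable_fun [set: _] (@tuncons n).
Proof.
apply/measurable_fun_pairP; split; last exact: measurable_behead.
rewrite (_ : _ \o _ = (@tnth _ _ ^~ ord0)); first exact: measurable_tnth.
by apply/funext => t /=.
Qed.

Lemma tconsK n : cancel (@tcons n) (@tuncons n).
Proof. by case=> x t; rewrite /tuncons theadE; congr pair; exact/val_inj. Qed.

Section step.
Variables (n : nat)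
  (m : {sigma_finite_measure set (n.-tuple (measurableTypeR R)) -> \bar R}).

Definition lebesgue_cons : set (n.+1.-tuple (measurableTypeR R)) -> \bar R :=
  pushforward (@lebesgue_measure R \x m)%E (@tcons n).

Let lebesgue_cons0 : lebesgue_cons set0 = 0%E.
Proof. by rewrite /lebesgue_cons /pushforward preimage_set0 measure0. Qed.

Let lebesgue_cons_ge0 A : (0 <= lebesgue_cons A)%E.
Proof. exact: (measure_ge0 (@lebesgue_measure R \x m)%E). Qed.

Let mpreimage_tcons A : measurable A -> measurable (@tcons n @^-1` A).
Proof. by move=> mA; rewrite -[X in measurable X]setTI; exact: measurable_tcons. Qed.

Let lebesgue_cons_sigma_additive : semi_sigma_additive lebesgue_cons.
Proof.
move=> F mF tF mUF; rewrite /lebesgue_cons /pushforward preimage_bigcup.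
apply: measure_semi_sigma_additive.
- by move=> i; exact: mpreimage_tcons.
- apply/trivIsetP => /= i j _ _ ij; rewrite -preimage_setI.
  by move/trivIsetP : tF => /(_ _ _ _ _ ij) ->//; rewrite preimage_set0.
- by rewrite -preimage_bigcup; exact: mpreimage_tcons.
Qed.

HB.instance Definition _ := isMeasure.Build _ _ _ lebesgue_cons
  lebesgue_cons0 lebesgue_cons_ge0 lebesgue_cons_sigma_additive.

Let lebesgue_cons_sigma_finite : sigma_finite setT lebesgue_cons.
Proof.
have /sigma_finiteP[F [FT ndF Foo]] := sigma_finiteT (@lebesgue_measure R).
have /sigma_finiteP[G [GT ndG Goo]] := sigma_finiteT m.
exists (fun i => @tuncons n @^-1` (F i `*` G i)).
  rewrite -preimage_bigcup; apply/esym/seteqP; split => // t _.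
  have [i _ Fi] : (\bigcup_k F k) (tuncons t).1 by rewrite -FT.
  have [j _ Gj] : (\bigcup_k G k) (tuncons t).2 by rewrite -GT.
  exists (maxn i j) => //; split.
    by move: Fi; exact/subsetPset/ndF/leq_maxl.
  by move: Gj; exact/subsetPset/ndG/leq_maxr.
move=> i; have [mF Fi] := Foo i; have [mG Gi] := Goo i; split.
  rewrite -[X in measurable X]setTI; apply: measurable_tuncons => //.
  exact: measurableX.
rewrite /lebesgue_cons /pushforward -comp_preimage.
rewrite (_ : _ \o _ = id) ?preimage_id; last by apply/funext => p; exact: tconsK.
by rewrite product_measure1E// lte_mul_pinfty// ge0_fin_numE.
Qed.

HB.instance Definition _ := @isSigmaFinite.Build _ _ _ lebesgue_cons
  lebesgue_cons_sigma_finite.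
HB.instance Definition _ := @isSFinite.Build _ _ _ lebesgue_cons
  (sfinite_measure_sigma_finite lebesgue_cons_sigma_finite).
End step.

Fixpoint lebesgue_tuple n :
    {sigma_finite_measure set (n.-tuple (measurableTypeR R)) -> \bar R} :=
  match n with
  | 0 => \d_([tuple] : 0.-tuple (measurableTypeR R))
  | n'.+1 => lebesgue_cons (lebesgue_tuple n')
  end.
End lebesgue_tuple.

Notation space R d := (d.-tuple (measurableTypeR R)).
Notation field R d := (space R d -> R).

Section function_spaces.
Variables (R : realType) (d : nat) (ell : 'I_d -> R).

Definition cell : set (space R d) :=
  [set x | forall i, 0 <= (tnth x i : R) < ell i].

Definition translate (i : 'I_d) (x : space R d) : space R d :=
  [tuple (tnth x j : R) + (if j == i then ell i else 0) | j < d].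

Definition periodic (f : field R d) := forall i x, f (translate i x) = f x.

Definition periodic_L2 : set (field R d) :=
  [set f | [/\ periodic f, measurable_fun cell f &
    (lebesgue_tuple R d).-integrable cell (fun x => (f x ^+ 2)%:E)]].

Definition ae_equal (f g : field R d) := ae_eq (lebesgue_tuple R d) cell f g.

Definition integral_cell (f : field R d) : R :=
  \int[lebesgue_tuple R d]_(x in cell) f x.

Definition inner (f g : field R d) : R := integral_cell (fun x => f x * g x).

(* Operators may be unbounded: they are total functions on fields of which only
   the restriction to a domain D is meaningful, and fields that agree almost
   everywhere on the cell are identified. *)
Definition linear_subspace (D : set (field R d)) :=
  D (fun=> 0) /\
  forall (a : R) f g, D f -> D g -> D (fun x => a * f x + g x).

Definition linear_on (D : set (field R d)) (A : field R d -> field R d) :=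
  forall (a : R) f g, D f -> D g ->
    ae_equal (A (fun x => a * f x + g x)) (fun x => a * A f x + A g x).

Definition symmetric_on (D : set (field R d)) (A : field R d -> field R d) :=
  forall f g, D f -> D g -> inner (A f) g = inner f (A g).

Definition skew_symmetric_on (D : set (field R d))
    (A : field R d -> field R d) :=
  forall f g, D f -> D g -> inner (A f) g = - inner f (A g).

Definition semi_positive_on (D : set (field R d))
    (A : field R d -> field R d) :=
  forall f, D f -> 0 <= inner (A f) f.

End function_spaces.

Section rmsav_bdf2.
Variables (R : realType) (d k : nat) (ell : 'I_d -> R).
Variables (L G : field R d -> field R d) (F : 'I_k -> R -> R).
Variables (gamma C : 'I_k -> R).

Definition radicand (i : 'I_k) (phi : field R d) : R :=
  integral_cell ell (fun x => F i (phi x) - gamma i / 2 * phi x ^+ 2) + C i.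

Definition Q (i : 'I_k) (phi : field R d) : R := Num.sqrt (radicand i phi).

Definition V (i : 'I_k) (phi : field R d) : field R d :=
  fun x => derive1 (F i) (phi x) - gamma i * phi x.

Definition regularized (f : field R d) : field R d :=
  fun x => L f x + (\sum_(i < k) gamma i) * f x.

Definition extrapolation (phi1 phi0 : field R d) : field R d :=
  fun x => 3 / 2 * phi1 x - 1 / 2 * phi0 x.

Definition bdf2 (dt : R) (phi2 phi1 phi0 : field R d) : field R d :=
  fun x => (3 * phi2 x - 4 * phi1 x + phi0 x) / (2 * dt).

(* In the definitions below the suffixes 0, 1, 2 stand for the time levels
   n - 1, n, n + 1, and [qt2], [mu2] for the intermediate \tilde q^{n+1} and
   \mu^{n+1}. *)
Definition rmsav_step1 (dt : R) (phi0 phi1 : field R d) (q0 q1 : 'I_k -> R)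
    (phi2 mu2 : field R d) (qt2 : 'I_k -> R) : Prop :=
  let phibar := extrapolation phi1 phi0 in
  [/\ ae_equal ell (bdf2 dt phi2 phi1 phi0) (fun x => - G mu2 x),
      ae_equal ell mu2 (fun x => L phi2 x + \sum_(i < k) gamma i * phi2 x
        + \sum_(i < k) qt2 i / Q i phibar * V i phibar x) &
      forall j, (3 * qt2 j - 4 * q1 j + q0 j) / (2 * dt) =
        integral_cell ell (fun x => V j phibar x / (2 * Q j phibar)
          * bdf2 dt phi2 phi1 phi0 x)].

Definition relaxed (xi : R) (phi2 : field R d) (qt2 : 'I_k -> R) (i : 'I_k) : R :=
  xi * qt2 i + (1 - xi) * Q i phi2.

Definition relaxation_set (dt eta : R) (q1 : 'I_k -> R) (phi2 mu2 : field R d)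
    (qt2 : 'I_k -> R) : set R :=
  [set xi | 0 <= xi <= 1 /\
    \sum_(i < k) (relaxed xi phi2 qt2 i ^+ 2
                    + (2 * relaxed xi phi2 qt2 i - q1 i) ^+ 2
                    - (qt2 i ^+ 2 + (2 * qt2 i - q1 i) ^+ 2))
    <= dt * eta * inner ell (G mu2) mu2].

Definition rmsav_step2 (dt eta : R) (q1 : 'I_k -> R) (phi2 mu2 : field R d)
    (qt2 q2 : 'I_k -> R) : Prop :=
  exists2 xi0, relaxation_set dt eta q1 phi2 mu2 qt2 xi0 &
    forall i, q2 i = relaxed xi0 phi2 qt2 i.

(* The weight 1/2 of the auxiliary variables is the one for which the energy is
   consistent: with constant histories it equals
   (phi, (L + sum_i gamma_i I) phi) / 2 + sum_i q_i ^ 2.  With weight 1 the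
   dissipation law fails, already for L = G = I and F_1(y) = (y - 3)^2 / 6. *)
Definition discrete_energy (phi0 phi1 : field R d) (q0 q1 : 'I_k -> R) : R :=
  let dphi : field R d := fun x => 2 * phi1 x - phi0 x in
  1 / 4 * (inner ell phi1 (regularized phi1) + inner ell dphi (regularized dphi))
  + 1 / 2 * \sum_(i < k) (q1 i ^+ 2 + (2 * q1 i - q0 i) ^+ 2).

End rmsav_bdf2.

(* Main.v *)
Require Import Defs.
From mathcomp Require Import all_boot all_order all_algebra.
From mathcomp Require Import all_classical all_reals all_analysis.
From mathcomp Require Import measurable_realfun ring lra.

(** The law is the energy method: write M = L + sum_i gamma_i I, let
    delta = (3 phi2 - 4 phi1 + phi0) / (2 dt) be the BDF2 difference, and test
    the equation for mu with delta.

    On one side, (delta, mu) = - (G mu, mu) by the evolution equation.  On the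
    other side, (delta, mu) splits into (delta, M phi2), a quadratic part, and
    the nonlinear part sum_i (qt_i / Q_i) (delta, V_i).  The auxiliary equation
    is designed so that, multiplied by 2 dt qt_i, its right-hand side is dt
    times that nonlinear term:
      (3 qt_i - 4 q1_i + q0_i) qt_i = dt (qt_i / Q_i) (delta, V_i).
    The nonlinearity thus disappears, and what remains are two instances of
    the identity
      2 (3 a - 4 b + c) a =
        a^2 + (2 a - b)^2 - (b^2 + (2 b - c)^2) + (a - 2 b + c)^2,
    one for the real numbers q and one, [bdf2_form_identity], for the symmetric
    form (f, M g).  Each turns the BDF2 difference into a difference of
    energies plus a square.  Semi-positivity of M makes the square of the form
    nonnegative, so [step1_energy_law] holds: replacing q^{n+1} by qt^{n+1}, the
    energy drops by at least dt (G mu, mu), whatever the size of dt.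

    The relaxation then replaces qt by q and, by the definition of the
    admissible set, raises the energy by at most dt eta (G mu, mu) / 2, which is
    at most dt eta (G mu, mu) since (G mu, mu) is nonnegative
    ([mobility_ge0]).

    As the operators act on functions and equations hold almost everywhere,
    these manipulations rest on the inner product being bilinear and
    insensitive to null sets on square integrable fields ([inner_linearl],
    [eq_innerr]). *)

Set Implicit Arguments.
Unset Strict Implicit.
Unset Printing Implicit Defensive.
Import Order.TTheory GRing.Theory Num.Theory.
Import numFieldNormedType.Exports.

Local Open Scope classical_set_scope.
Local Open Scope ring_scope.

(** * Square integrable fields on the periodic cell *)

Section square_integrable_fields.
Variables (R : realType) (d : nat) (ell : 'I_d -> R).
Implicit Types f g h : field R d.

Let lambda := lebesgue_tuple R d.

(** Membership in L^2 of the cell, separated from [periodic_L2] so that closure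
    under sums and products is a matter of measure theory alone. *)
Definition cell_L2 f := measurable_fun (cell ell) f /\
  lambda.-integrable (cell ell) (fun x => (f x ^+ 2)%:E).

Lemma periodic_L2_cell_L2 f : periodic_L2 ell f -> cell_L2 f.
Proof. by case. Qed.

Lemma measurable_cell : measurable (cell ell).
Proof.
have -> : cell ell = \bigcap_(i in [set: 'I_d])
    ((fun x : d.-tuple (measurableTypeR R) => tnth x i) @^-1` `[0, ell i[).
  apply/seteqP; split => x /= cx i.
    by move=> _ /=; rewrite in_itv/= cx.
  by have := cx i I; rewrite /= in_itv.
apply: fin_bigcap_measurable => // i _; rewrite -[X in measurable X]setTI.
exact: measurable_tnth.
Qed.

(** Domination by f^2 + g^2. *)
Lemma cell_L2_integrableM f g : cell_L2 f -> cell_L2 g ->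
  lambda.-integrable (cell ell) (fun x => (f x * g x)%:E).
Proof.
move=> [mf f2] [mg g2].
apply: (@le_integrable _ _ _ lambda _ measurable_cell _
    (fun x => (f x ^+ 2 + g x ^+ 2)%:E)).
- by apply/measurable_EFinP; exact: measurable_funM.
- move=> x _; rewrite lee_fin [leRHS]ger0_norm ?addr_ge0 ?sqr_ge0//.
  by rewrite ler_norml; apply/andP; split; nra.
- by apply: (integrableD measurable_cell f2 g2).
Qed.

Lemma cell_L2_linear (a : R) f g :
  cell_L2 f -> cell_L2 g -> cell_L2 (fun x => a * f x + g x).
Proof.
move=> Lf Lg; have [mf f2] := Lf; have [mg g2] := Lg; split.
  by apply: measurable_funD => //; exact: measurable_funM.
have fg := cell_L2_integrableM Lf Lg; have mC := measurable_cell.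
apply: (@eq_integrable _ _ _ lambda _ mC (fun x =>
    ((a ^+ 2)%:E * (f x ^+ 2)%:E + ((2 * a)%:E * (f x * g x)%:E
      + (g x ^+ 2)%:E))%E)).
  by move=> x _; rewrite -!EFinM -!EFinD; congr EFin; ring.
by apply: integrableD => //; [|apply: integrableD => //]; exact: integrableZl.
Qed.

Lemma cell_L2_0 : cell_L2 (fun=> 0).
Proof.
split; first exact: measurable_cst.
under eq_fun do rewrite expr0n; exact: integrable0.
Qed.

Lemma cell_L2_sum I (s : seq I) (c : I -> R) (f : I -> field R d) :
  (forall i, cell_L2 (f i)) -> cell_L2 (fun x => \sum_(i <- s) c i * f i x).
Proof.
move=> Lf; elim: s => [|i s IHs].
  by under eq_fun do rewrite big_nil; exact: cell_L2_0.
by under eq_fun do rewrite big_cons; exact: cell_L2_linear.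
Qed.

Lemma innerC f g : inner ell f g = inner ell g f.
Proof. by apply: eq_Rintegral => x _; rewrite mulrC. Qed.

Lemma inner_linearl (a : R) f g h : cell_L2 f -> cell_L2 g -> cell_L2 h ->
  inner ell (fun x => a * f x + g x) h = a * inner ell f h + inner ell g h.
Proof.
move=> Lf Lg Lh; have mC := measurable_cell.
have fh := cell_L2_integrableM Lf Lh; have gh := cell_L2_integrableM Lg Lh.
rewrite /inner /integral_cell -RintegralZl// -RintegralD//.
  by apply: eq_Rintegral => x _; ring.
under [X in _.-integrable _ X]eq_fun do rewrite /= EFinM.
exact: integrableZl.
Qed.

Lemma inner0l g : inner ell (fun=> 0) g = 0.
Proof.
rewrite /inner /integral_cell /Rintegral.
by under eq_integral do rewrite mul0r; rewrite integral0.
Qed.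

Lemma inner_scalel (a : R) f g : cell_L2 f -> cell_L2 g ->
  inner ell (fun x => a * f x) g = a * inner ell f g.
Proof.
move=> Lf Lg; rewrite -[RHS]addr0 -(inner0l g) -inner_linearl//.
  by under [in RHS]eq_fun do rewrite addr0.
exact: cell_L2_0.
Qed.

Lemma inner_sumr I (s : seq I) (c : I -> R) (f : I -> field R d) h :
  (forall i, cell_L2 (f i)) -> cell_L2 h ->
  inner ell h (fun x => \sum_(i <- s) c i * f i x)
    = \sum_(i <- s) c i * inner ell h (f i).
Proof.
move=> Lf Lh; rewrite innerC; elim: s => [|i s IHs].
  by under eq_fun do rewrite big_nil; rewrite big_nil inner0l.
under eq_fun do rewrite big_cons.
by rewrite big_cons inner_linearl// ?IHs 1?innerC//; exact: cell_L2_sum.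
Qed.

(** Operators and schemes are only specified almost everywhere; measurability
    is what lets the integral ignore the exceptional set. *)
Lemma eq_innerr f g h : cell_L2 f -> cell_L2 g -> cell_L2 h ->
  ae_equal ell f g -> inner ell h f = inner ell h g.
Proof.
move=> [mf _] [mg _] [mh _] fg; rewrite /inner /integral_cell /Rintegral.
congr fine; apply: ae_eq_integral.
- exact: measurable_cell.
- by apply/measurable_EFinP; exact: measurable_funM.
- by apply/measurable_EFinP; exact: measurable_funM.
- by apply: filterS fg => x /[swap] /= Cx /(_ Cx) ->.
Qed.

End square_integrable_fields.

(** * The telescoping identity of the BDF2 difference *)

Section bdf2_identity.
Variables (R : realType) (d : nat) (D : set (field R d)).
Variable B : field R d -> field R d -> R.
Hypothesis D_subspace : linear_subspace D.
Hypothesis B_linearl : forall (a : R) f g h, D f -> D g -> D h ->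
  B (fun x => a * f x + g x) h = a * B f h + B g h.
Hypothesis B_sym : forall f g, D f -> D g -> B f g = B g f.

(** Extrapolation and differences are combinations of at most three time levels;
    the trailing zero presents such a combination as a chain of steps a f + g, the only operation
    under which linear subspaces are known to be closed. *)
Let comb (f0 f1 f2 : field R d) (a b c : R) : field R d :=
  fun x => a * f2 x + (b * f1 x + (c * f0 x + 0)).

Let D_comb f0 f1 f2 a b c : D f0 -> D f1 -> D f2 -> D (comb f0 f1 f2 a b c).
Proof. by have [D0 DD] := D_subspace; move=> *; do 3 apply: (DD) => //. Qed.

Let B_comb f0 f1 f2 a b c h : D f0 -> D f1 -> D f2 -> D h ->
  B (comb f0 f1 f2 a b c) h = a * B f2 h + b * B f1 h + c * B f0 h.
Proof.
have [D0 DD] := D_subspace; move=> Df0 Df1 Df2 Dh.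
have B0 : B (fun=> 0) h = 0.
  have := B_linearl 1 D0 D0 Dh; under eq_fun do rewrite mulr0 addr0.
  by lra.
have Dc := DD c _ _ Df0 D0; have Db := DD b _ _ Df1 Dc.
by rewrite /comb !B_linearl// B0; ring.
Qed.

Let bdf2_comb dt f0 f1 f2 : dt != 0 ->
  bdf2 dt f2 f1 f0 =
    comb f0 f1 f2 (3 / (2 * dt)) (- 4 / (2 * dt)) (1 / (2 * dt)).
Proof. by move=> dt0; apply/funext => x; rewrite /bdf2 /comb; field. Qed.

Lemma linear_subspace_bdf2 dt f0 f1 f2 : dt != 0 ->
  D f0 -> D f1 -> D f2 -> D (bdf2 dt f2 f1 f0).
Proof. by move=> dt0 *; rewrite bdf2_comb//; exact: D_comb. Qed.

Lemma linear_subspace_extrapolation f0 f1 :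
  D f0 -> D f1 -> D (extrapolation f1 f0).
Proof.
move=> Df0 Df1.
rewrite (_ : extrapolation _ _ = comb f0 f1 f1 0 (3 / 2) (- (1 / 2))).
  exact: D_comb.
by apply/funext => x; rewrite /extrapolation /comb; ring.
Qed.

(** The G-stability of BDF2.  The identity holds for real numbers, and its proof
    only uses that multiplication is bilinear and symmetric.  The witness [e] is
    the second difference f2 - 2 f1 + f0; all that matters is that it lies in
    [D], where a semi-positive form is nonnegative on the diagonal. *)
Lemma bdf2_form_identity dt f0 f1 f2 : dt != 0 -> D f0 -> D f1 -> D f2 ->
  exists2 e, D e &
  4 * dt * B (bdf2 dt f2 f1 f0) f2 =
    (B f2 f2 + B (fun x => 2 * f2 x - f1 x) (fun x => 2 * f2 x - f1 x))
    - (B f1 f1 + B (fun x => 2 * f1 x - f0 x) (fun x => 2 * f1 x - f0 x))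
    + B e e.
Proof.
move=> dt0 Df0 Df1 Df2.
exists (comb f0 f1 f2 1 (- 2) 1); first exact: D_comb.
rewrite bdf2_comb//.
rewrite (_ : (fun x => 2 * f2 x - f1 x) = comb f0 f1 f2 2 (- 1) 0); last first.
  by apply/funext => x; rewrite /comb; ring.
rewrite (_ : (fun x => 2 * f1 x - f0 x) = comb f0 f1 f2 0 2 (- 1)); last first.
  by apply/funext => x; rewrite /comb; ring.
(* Expanding every term over the six values of B on f0, f1 and f2 reduces
   the claim to a polynomial identity. *)
have Bcc a b c a' b' c' : B (comb f0 f1 f2 a b c) (comb f0 f1 f2 a' b' c') =
    a * (a' * B f2 f2 + b' * B f1 f2 + c' * B f0 f2)
    + b * (a' * B f1 f2 + b' * B f1 f1 + c' * B f0 f1)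
    + c * (a' * B f0 f2 + b' * B f0 f1 + c' * B f0 f0).
  rewrite B_comb//; last exact: D_comb.
  rewrite !(B_sym _ (D_comb _ _ _ Df0 Df1 Df2))// !B_comb//.
  by rewrite (B_sym Df2 Df1) (B_sym Df2 Df0) (B_sym Df1 Df0).
by rewrite !Bcc B_comb//; field.
Qed.

End bdf2_identity.

(** * Dissipation of the modified energy *)

Section one_step.
Variables (R : realType) (d k : nat) (ell : 'I_d -> R).
Variables (DL : set (field R d)) (L G : field R d -> field R d).
Variables (F : 'I_k -> R -> R) (gamma C : 'I_k -> R).
Hypothesis DL_subspace : linear_subspace DL.
Hypothesis DL_L2 : forall f, DL f -> cell_L2 ell f.
Hypothesis L_L2 : forall f, DL f -> cell_L2 ell (L f).
Hypothesis L_sym : symmetric_on ell DL L.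
Hypothesis L_ge0 : semi_positive_on ell DL (regularized L gamma).
Hypothesis dF_L2 :
  forall i f, DL f -> cell_L2 ell (fun x => derive1 (F i) (f x)).

Let B f g := inner ell f (regularized L gamma g).

Lemma regularizedE f :
  regularized L gamma f = fun x => (\sum_(i < k) gamma i) * f x + L f x.
Proof. by apply/funext => x; rewrite /regularized addrC. Qed.

Lemma regularized_L2 f : DL f -> cell_L2 ell (regularized L gamma f).
Proof.
move=> Df; rewrite regularizedE.
by apply: cell_L2_linear; [exact: DL_L2|exact: L_L2].
Qed.

Lemma V_L2 i f : DL f -> cell_L2 ell (V F gamma i f).
Proof.
move=> Df; rewrite (_ : V F gamma i f =
    fun x => - gamma i * f x + derive1 (F i) (f x)).
  by apply: cell_L2_linear; [exact: DL_L2|exact: dF_L2].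
by apply/funext => x; rewrite /V; ring.
Qed.

(** Symmetry of L together with that of the scalar shift: (f, M g) is the
    symmetric form to which the BDF2 identity is applied. *)
Lemma inner_regularizedC f g : DL f -> DL g ->
  inner ell f (regularized L gamma g) = inner ell g (regularized L gamma f).
Proof.
move=> Df Dg; rewrite !regularizedE [LHS]innerC [RHS]innerC.
rewrite !inner_linearl; try by [exact: DL_L2|exact: L_L2].
by rewrite L_sym// [inner ell g f]innerC [inner ell g (L f)]innerC.
Qed.

(** The energy law before relaxation, with qt2 in place of q2.  Testing the
    chemical potential with the BDF2 difference leaves the form (f, M g) and a
    nonlinear sum S; the auxiliary equations show that 2 dt S dominates the
    increase of the squares of the auxiliary variables. *)
Lemma step1_energy_law dt phi0 phi1 q0 q1 phi2 mu2 qt2 : 0 < dt ->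
  DL phi0 -> DL phi1 -> DL phi2 -> cell_L2 ell mu2 -> cell_L2 ell (G mu2) ->
  (forall i, 0 < radicand ell F gamma C i (extrapolation phi1 phi0)) ->
  rmsav_step1 ell L G F gamma C dt phi0 phi1 q0 q1 phi2 mu2 qt2 ->
  discrete_energy ell L gamma phi1 phi2 q1 qt2
    - discrete_energy ell L gamma phi0 phi1 q0 q1
  <= - dt * inner ell (G mu2) mu2.
Proof.
move=> dt_gt0 D0 D1 D2 Lmu LGmu radicand_gt0 [].
set pb := extrapolation phi1 phi0; set dphi := bdf2 dt phi2 phi1 phi0.
move=> eq_phi eq_mu eq_q.
have dt0 : dt != 0 by rewrite gt_eqF.
have Dpb : DL pb by exact: (linear_subspace_extrapolation DL_subspace D0 D1).
have Ldphi : cell_L2 ell dphi.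
  by apply: DL_L2; exact: (linear_subspace_bdf2 DL_subspace).
have LV i : cell_L2 ell (V F gamma i pb) by exact: V_L2.
have Q0 i : Q ell F gamma C i pb != 0 by rewrite gt_eqF// sqrtr_gt0.
pose c i := qt2 i / Q ell F gamma C i pb.
pose S := \sum_(i < k) c i * inner ell dphi (V F gamma i pb).
(* The evolution equation tested with mu2. *)
have testG : inner ell dphi mu2 = - inner ell (G mu2) mu2.
  rewrite innerC (eq_innerr _ _ _ eq_phi)//.
    rewrite innerC; under [X in inner _ X]eq_fun do rewrite -mulN1r.
    by rewrite inner_scalel// mulN1r.
  under eq_fun do rewrite -[- _]addr0 -mulN1r.
  by apply: cell_L2_linear => //; exact: cell_L2_0.
have test_mu : inner ell dphi mu2 = B dphi phi2 + S.
  have mu2E : (fun x => L phi2 x + \sum_(i < k) gamma i * phi2 x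
        + \sum_(i < k) qt2 i / Q ell F gamma C i pb * V F gamma i pb x) =
      (fun x => 1 * regularized L gamma phi2 x
        + \sum_(i < k) c i * V F gamma i pb x).
    by apply/funext => x; rewrite mul1r /regularized mulr_suml.
  rewrite mu2E in eq_mu; have LS := cell_L2_sum (index_enum 'I_k) c LV.
  rewrite (eq_innerr Lmu _ Ldphi eq_mu); last first.
    by apply: cell_L2_linear => //; exact: regularized_L2.
  rewrite innerC inner_linearl//; last exact: regularized_L2.
  by rewrite mul1r innerC [X in _ + X]innerC inner_sumr.
have testq i : (3 * qt2 i - 4 * q1 i + q0 i) * qt2 i
    = dt * (c i * inner ell dphi (V F gamma i pb)).
  have := eq_q i.
  have -> : integral_cell ell (fun x => V F gamma i pb x
        / (2 * Q ell F gamma C i pb) * dphi x)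
      = (2 * Q ell F gamma C i pb)^-1 * inner ell dphi (V F gamma i pb).
    rewrite [inner _ dphi _]innerC -inner_scalel//.
    by congr integral_cell; apply/funext => x; ring.
  move=> eq_qi; have -> : 3 * qt2 i - 4 * q1 i + q0 i = 2 * dt *
      ((2 * Q ell F gamma C i pb)^-1 * inner ell dphi (V F gamma i pb)).
    by rewrite -eq_qi; field.
  by rewrite /c; field.
(* The BDF2 identity for real numbers, with its square discarded. *)
have qsum : \sum_(i < k) (qt2 i ^+ 2 + (2 * qt2 i - q1 i) ^+ 2)
    - \sum_(i < k) (q1 i ^+ 2 + (2 * q1 i - q0 i) ^+ 2) <= 2 * (dt * S).
  rewrite -sumrB /S !mulr_sumr; apply: ler_sum => i _.
  by rewrite -testq; have := sqr_ge0 (qt2 i - 2 * q1 i + q0 i); nra.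
have B_linearl (a : R) f g h : DL f -> DL g -> DL h ->
    B (fun x => a * f x + g x) h = a * B f h + B g h.
  by move=> *; apply: inner_linearl; do ?[exact: DL_L2|exact: regularized_L2].
have [e De phisum] := bdf2_form_identity DL_subspace B_linearl
  inner_regularizedC dt0 D0 D1 D2.
have Be : 0 <= B e e by rewrite /B innerC; exact: L_ge0.
move: phisum; rewrite -/dphi /discrete_energy /= -/(B _ _) -/(B _ _).
move: test_mu; rewrite testG => test_mu phisum.
have := congr1 (fun x => dt * x) test_mu; rewrite /= mulrDr => test_mu'.
rewrite mulNr -mulrN test_mu'; move: phisum qsum Be.
rewrite /B -mulrA; set X1 := dt * S; set X2 := dt * inner _ _ _.
by lra.
Qed.

End one_step.

(** * Energy stability of the scheme *)

(** In the reversible case (G mu, mu) equals its own opposite, hence is zero. *)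
Lemma mobility_ge0 (R : realType) (d : nat) (ell : 'I_d -> R)
    (DG : set (field R d)) (G : field R d -> field R d) mu :
  semi_positive_on ell DG G \/ skew_symmetric_on ell DG G -> DG mu ->
  0 <= inner ell (G mu) mu.
Proof.
move=> [G_ge0|G_skew] Dmu; first exact: G_ge0.
by have := G_skew _ _ Dmu Dmu; rewrite [inner _ mu _]innerC; lra.
Qed.

Theorem theorem3p3 (R : realType) (d k : nat) (ell : 'I_d -> R)
    (DL DG : set (field R d)) (L G : field R d -> field R d)
    (F : 'I_k -> R -> R) (gamma C : 'I_k -> R) (T eta : R) (N : nat)
    (phi mu : nat -> field R d) (q qt : nat -> 'I_k -> R) :
  let dt := T / N%:R in
  let E n := discrete_energy ell L gamma
               (phi n.-1) (phi n) (q n.-1) (q n) in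
  (* the periodic domain *)
  (forall i, 0 < ell i) ->
  (* L is linear and symmetric, L + sum_i gamma_i I is semi-positive definite *)
  linear_subspace DL ->
  DL `<=` periodic_L2 ell ->
  (forall f, DL f -> periodic_L2 ell (L f)) ->
  linear_on ell DL L ->
  symmetric_on ell DL L ->
  semi_positive_on ell DL (regularized L gamma) ->
  (* the mobility is semi-positive definite or skew-symmetric *)
  DG `<=` periodic_L2 ell ->
  (forall f, DG f -> periodic_L2 ell (G f)) ->
  semi_positive_on ell DG G \/ skew_symmetric_on ell DG G ->
  (* the bulk potentials *)
  (forall i y, derivable (F i) y 1) ->
  (forall i f, DL f ->
     (lebesgue_tuple R d).-integrable (cell ell) (fun x => (F i (f x))%:E)) ->
  (forall i f, DL f -> periodic_L2 ell (fun x => derive1 (F i) (f x))) ->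
  (forall i, 0 < C i) ->
  (forall i f, DL f -> 0 < radicand ell F gamma C i f) ->
  (* the time grid and the parameter of the relaxation *)
  0 < T -> (0 < N)%N -> 0 <= eta <= 1 ->
  (* a solution of the scheme *)
  (forall n, (n <= N)%N -> DL (phi n)) ->
  (forall n, (1 < n <= N)%N -> DG (mu n)) ->
  (forall n, (1 <= n < N)%N ->
     rmsav_step1 ell L G F gamma C dt (phi n.-1) (phi n) (q n.-1) (q n)
       (phi n.+1) (mu n.+1) (qt n.+1) /\
     rmsav_step2 ell G F gamma C dt eta (q n) (phi n.+1) (mu n.+1)
       (qt n.+1) (q n.+1)) ->
  forall n, (1 <= n < N)%N ->
    E n.+1 - E n <= - dt * (1 - eta) * inner ell (G (mu n.+1)) (mu n.+1) /\
    - dt * (1 - eta) * inner ell (G (mu n.+1)) (mu n.+1) <= 0.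
Proof.
move=> dt E _ DL_subspace DL_L2 L_L2 _ L_sym L_ge0 DG_L2 G_L2 G_mob _ _ dF_L2 _.
move=> radicand_gt0 T_gt0 N_gt0 eta01 Dphi Dmu scheme n nN.
have dt_gt0 : 0 < dt by rewrite divr_gt0// ltr0n.
have [n_gt0 ltnN] := andP nN.
have Dmun : DG (mu n.+1) by apply: Dmu; rewrite !ltnS n_gt0.
have diss_ge0 := mobility_ge0 G_mob Dmun.
have [step1 [xi [_ relax] q2E]] := scheme n nN.
have D0 : DL (phi n.-1).
  exact/Dphi/(leq_trans (leq_pred n))/ltnW.
have D1 : DL (phi n) by apply/Dphi/ltnW.
have D2 : DL (phi n.+1) by exact: Dphi.
have law := step1_energy_law DL_subspace
  (fun f Df => periodic_L2_cell_L2 (DL_L2 f Df))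
  (fun f Df => periodic_L2_cell_L2 (L_L2 f Df)) L_sym L_ge0
  (fun i f Df => periodic_L2_cell_L2 (dF_L2 i f Df)) dt_gt0 D0 D1 D2
  (periodic_L2_cell_L2 (DG_L2 _ Dmun)) (periodic_L2_cell_L2 (G_L2 _ Dmun))
  (fun i => radicand_gt0 i _ (linear_subspace_extrapolation DL_subspace D0 D1))
  step1.
have eta_ge0 : 0 <= eta by case/andP: eta01.
have eta_le1 : eta <= 1 by case/andP: eta01.
have dis2 := mulr_ge0 (ltW dt_gt0) diss_ge0.
have dis3 := mulr_ge0 eta_ge0 dis2.
have dis4 : 0 <= (1 - eta) * (dt * inner ell (G (mu n.+1)) (mu n.+1)).
  by rewrite mulr_ge0// subr_ge0.
split; last by lra.
(* Half of the left-hand side of the relaxation inequality is exactly what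
   the energy gains when qt is replaced by the relaxed q. *)
have relaxE : E n.+1 =
    discrete_energy ell L gamma (phi n) (phi n.+1) (q n) (qt n.+1)
    + 1 / 2 * \sum_(i < k) (relaxed ell F gamma C xi (phi n.+1) (qt n.+1) i ^+ 2
          + (2 * relaxed ell F gamma C xi (phi n.+1) (qt n.+1) i - q n i) ^+ 2
          - (qt n.+1 i ^+ 2 + (2 * qt n.+1 i - q n i) ^+ 2)).
  rewrite /E /discrete_energy /= sumrB mulrBr addrA.
  under eq_bigr do rewrite q2E.
  by ring.
rewrite relaxE /E; move: law relax dis3.
set S := \sum_(i < k) _; set e1 := discrete_energy _ _ _ _ _ _ _.
set e0 := discrete_energy _ _ _ _ _ _ _; set I0 := inner _ _ _.
by lra.
Qed.
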